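(* The functions $F_n, G_n, U_n, J_n$ satisfy the following three-term recurrence relations. (i) For all integers $n\ge 1$ and all $x\in[0,1]$, $$2(n+1)F_{n+1}(x)=(2n+1)\bigl(1+(1-2x)^{2}\bigr)F_{n}(x)-2n(1-2x)^{2}F_{n-1}(x).$$ (ii) For all integers $n\ge 2$ and all $x\in[0,+\infty)$, $$n(1+2x)^{2}G_{n+1}(x)=(2n-1)\bigl(1+2x+2x^{2}\bigr)G_{n}(x)-(n-1)G_{n-1}(x).$$ (iii) For all integers $n\ge 1$ and all $t\in[0,+\infty)$, $$(n+1)(1+t)^{2}U_{n+1}(t)=(2n+1)(t^{2}+1)U_{n}(t)-n(1-t)^{2}U_{n-1}(t).$$ (iv) For all integers $n\ge 1$ and all $t\in[0,1)$, $$(n+1)(1+t)^{2}J_{n+1}(t)=(2n+1)(t^{2}+1)J_{n}(t)-n(1-t)^{2}J_{n-1}(t).$$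
   Context: The functions are defined as follows (with the convention $0^0=1$): $$F_n(x)=\sum_{k=0}^{n}\left(\binom{n}{k}x^{k}(1-x)^{n-k}\right)^{2},\quad x\in[0,1],\ n=0,1,2,\dots$$ $$G_n(x)=\sum_{k=0}^{\infty}\left(\binom{n+k-1}{k}x^{k}(1+x)^{-n-k}\right)^{2},\quad x\in[0,+\infty),\ n=1,2,\dots$$ $$U_n(x)=\sum_{k=0}^{n}\left(\binom{n}{k}x^{k}(1+x)^{-n}\right)^{2},\quad x\in[0,+\infty),\ n=0,1,2,\dots$$ $$J_n(x)=\sum_{k=0}^{\infty}\left(\binom{n+k}{k}x^{k}(1-x)^{n+1}\right)^{2},\quad x\in[0,1),\ n=0,1,2,\dots$$ *)

(* Defs.v *)
From Stdlib Require Import Reals.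
From Coquelicot Require Import Coquelicot.
Open Scope R_scope.

(** Each function below is total on [R]; it carries its intended meaning on the
    domain stated next to it. Powers with natural exponents satisfy [0 ^ 0 = 1],
    and a negative power [a ^ (- m)] is written [/ a ^ m]. [Binomial.C] is
    qualified because Coquelicot also calls its type of complex numbers [C]; it
    agrees with the binomial coefficient only when the lower index is at most
    the upper one, which always holds below on the stated domains. *)

(** [0 <= x <= 1], [0 <= n]. *)
Definition F (n : nat) (x : R) : R :=
  sum_f_R0 (fun k => (Binomial.C n k * x ^ k * (1 - x) ^ (n - k)) ^ 2) n.

(** [0 <= x], [1 <= n]; the series converges there, so [Series] is its sum. *)
Definition G (n : nat) (x : R) : R :=
  Series (fun k => (Binomial.C (n + k - 1) k * x ^ k * / (1 + x) ^ (n + k)) ^ 2).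

(** [0 <= x], [0 <= n]. *)
Definition U (n : nat) (x : R) : R :=
  sum_f_R0 (fun k => (Binomial.C n k * x ^ k * / (1 + x) ^ n) ^ 2) n.

(** [0 <= x < 1], [0 <= n]; the series converges there, so [Series] is its sum. *)
Definition J (n : nat) (x : R) : R :=
  Series (fun k => (Binomial.C (n + k) k * x ^ k * (1 - x) ^ (n + 1)) ^ 2).

(* Main.v *)
Require Import Defs.
From Stdlib Require Import Reals Lra Lia.
From Coquelicot Require Import Coquelicot.
Open Scope R_scope.

(** Why the four recurrences are one.  Let [B nu k] be the generalized binomial
    coefficient of a real [nu] over [k], and let [s nu] be the formal power
    series [sum_k (B nu k)^2 z^k].  For every real [nu],
    [(nu + 1) s (nu + 1) = (2 nu + 1) (1 + z) s nu - nu (1 - z)^2 s (nu - 1)].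
    Comparing coefficients of [z^k] and expressing everything by Pascal's rule
    through [B (nu - 1)] at [k], [k - 1], [k - 2], this becomes a quadratic
    relation between three consecutive entries of a row, and it follows from
    the two linear relations that give their ratios
    ([gbinom_sqr_three_term]).

    At [nu = n] the series is a polynomial of degree [n]; homogenized and
    evaluated at [(x^2, (1 - x)^2)] it is [F n x].  At [nu = - n - 1] one has
    [B nu k = (-1)^k C(n + k, k)], so at [z = t^2] the series is [J n t] up to
    the factor [(1 - t)^(2 n + 2)], and the same identity read with [nu]
    decreasing is the recurrence for [J].

    Finally the substitution [t |-> t / (1 + t)], under which [1 - x] becomes
    [1 / (1 + t)], carries [F n] to [U n] and [J (n - 1)] to [G n]; it maps the
    half-line [0 <= t] into [0 <= x < 1], hence into the disk of convergence. *)

(** * Generalized binomial coefficients *)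

(** The falling factorial [nu (nu - 1) ... (nu - k + 1)] over [k!], built
    through the ratio of consecutive terms, since that ratio is what the
    proofs and the convergence test use. *)
Fixpoint gbinom (nu : R) (k : nat) : R :=
  match k with
  | O => 1
  | S k' => gbinom nu k' * (nu - INR k') / (INR k' + 1)
  end.

Lemma gbinom_ratio (nu : R) (k : nat) :
  (INR k + 1) * gbinom nu (S k) = (nu - INR k) * gbinom nu k.
Proof.
simpl; pose proof (pos_INR k); field; lra.
Qed.

Lemma gbinom_pascal (nu : R) (k : nat) :
  gbinom (nu + 1) (S k) = gbinom nu (S k) + gbinom nu k.
Proof.
induction k as [|k IH]; [simpl; field|].
pose proof (pos_INR k).
pose proof (gbinom_ratio (nu + 1) (S k)) as H1.
pose proof (gbinom_ratio nu (S k)) as H2.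
pose proof (gbinom_ratio nu k) as H3.
rewrite IH in H1; rewrite S_INR in H1, H2.
apply Rmult_eq_reg_l with (INR k + 1 + 1); [|lra].
lra.
Qed.

Lemma gbinom_C (n k : nat) :
  (k <= n)%nat -> gbinom (INR n) k = Binomial.C n k.
Proof.
induction k as [|k IH]; intros Hk.
- rewrite C_n_0; reflexivity.
- rewrite pascal_step3 by lia; rewrite <- IH, minus_INR, S_INR by lia; simpl.
  pose proof (pos_INR k); field; lra.
Qed.

Lemma gbinom_vanish (n j : nat) : gbinom (INR n) (S n + j) = 0.
Proof.
induction j as [|j IH].
- rewrite Nat.add_0_r; simpl; unfold Rdiv; ring.
- rewrite Nat.add_succ_r; cbn [gbinom]; rewrite IH; unfold Rdiv; ring.
Qed.

Lemma C_diag_succ (n k : nat) :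
  (INR k + 1) * Binomial.C (n + S k) (S k)
  = (INR n + INR k + 1) * Binomial.C (n + k) k.
Proof.
pose proof (pos_INR k); pose proof (pos_INR n).
rewrite <- plus_n_Sm.
rewrite pascal_step3, pascal_step2 by lia.
replace (S (n + k) - k)%nat with (S n) by lia.
rewrite !S_INR, plus_INR; field; lra.
Qed.

(** The sign alternation disappears in the squares, so the row
    [nu = - n - 1] yields the coefficients [C(n + k, k)^2]. *)
Lemma gbinom_neg_C (n k : nat) :
  gbinom (- INR n - 1) k = (-1) ^ k * Binomial.C (n + k) k.
Proof.
induction k as [|k IH].
- rewrite C_n_0; simpl; ring.
- pose proof (pos_INR k).
  apply Rmult_eq_reg_l with (INR k + 1); [|lra].
  rewrite gbinom_ratio, IH.
  transitivity ((-1) ^ S k * ((INR k + 1) * Binomial.C (n + S k) (S k)));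
    [rewrite C_diag_succ; simpl|]; ring.
Qed.

Lemma gbinom_neg_neq_0 (nu : R) (k : nat) : nu < 0 -> gbinom nu k <> 0.
Proof.
intros Hnu; induction k as [|k IH]; simpl; [lra|].
pose proof (pos_INR k).
apply Rmult_integral_contrapositive_currified.
- apply Rmult_integral_contrapositive_currified; [exact IH|lra].
- apply Rinv_neq_0_compat; lra.
Qed.

(** * The recurrence on coefficients *)

Definition gbinom_sqr (nu : R) (k : nat) : R := gbinom nu k ^ 2.

(** [p], [q], [r] stand for three consecutive entries of the row [nu - 1], of
    indices [k], [k - 1], [k - 2].  Both sides differ by twice
    [(nu + 1) p r + p q + q r + (1 - nu) q^2], and splitting
    [nu + 1 = k + (nu - k + 1)] in the first term makes this vanish. *)
Lemma consecutive_row_identity (nu k p q r : R) :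
  k * p = (nu - k) * q -> (k - 1) * q = (nu - k + 1) * r ->
  (nu + 1) * (p + 2 * q + r) ^ 2
  = (2 * nu + 1) * ((p + q) ^ 2 + (q + r) ^ 2)
    - nu * (p ^ 2 - 2 * q ^ 2 + r ^ 2).
Proof.
intros Hp Hr.
assert (Hpr : (nu + 1) * (p * r) = (nu - k) * q * r + (k - 1) * q * p).
{ rewrite Hr, <- Hp; ring. }
assert (Hpq : k * p * q = (nu - k) * q * q) by (rewrite Hp; ring).
assert (Hqr : (k - 1) * q * q = (nu - k + 1) * r * q) by (rewrite Hr; ring).
nra.
Qed.

(** [PS_incr_1] is multiplication by [z] on coefficient sequences, so the last
    bracket holds the coefficients of [(1 - z)^2 s (nu - 1)]. *)
Lemma gbinom_sqr_three_term (nu : R) (k : nat) :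
  (nu + 1) * gbinom_sqr (nu + 1) k
  = (2 * nu + 1) * (gbinom_sqr nu k + PS_incr_1 (gbinom_sqr nu) k)
    - nu * (gbinom_sqr (nu - 1) k - 2 * PS_incr_1 (gbinom_sqr (nu - 1)) k
            + PS_incr_1 (PS_incr_1 (gbinom_sqr (nu - 1))) k).
Proof.
unfold gbinom_sqr.
destruct k as [|[|k]]; cbn [PS_incr_1]; change (@zero _) with 0.
- simpl; ring.
- simpl; field.
- assert (Hpas : forall j, gbinom nu (S j)
                  = gbinom (nu - 1) (S j) + gbinom (nu - 1) j).
  { intros j; rewrite <- gbinom_pascal; f_equal; ring. }
  pose proof (gbinom_ratio (nu - 1) k) as Hr.
  pose proof (gbinom_ratio (nu - 1) (S k)) as Hp.
  rewrite S_INR in Hp.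
  rewrite gbinom_pascal, !Hpas.
  rewrite <- (consecutive_row_identity nu (INR k + 1 + 1)) by lra.
  ring.
Qed.

(** * Homogeneous sums and the functions [F] and [U] *)

(** Homogenizing keeps the two ends of [0, 1] on the same footing: dividing by
    [(1 - x)^(2 n)] would exclude [x = 1]. *)
Definition hsum (c : nat -> R) (n : nat) (a b : R) : R :=
  sum_f_R0 (fun k => c k * a ^ k * b ^ (n - k)) n.

Lemma hsum_mul_l (c : nat -> R) (n : nat) (a b : R) :
  a * hsum c n a b = hsum (PS_incr_1 c) (S n) a b.
Proof.
unfold hsum; rewrite scal_sum, (decomp_sum _ (S n)) by lia.
cbn [PS_incr_1 Nat.pred]; change (@zero _) with 0.
rewrite !Rmult_0_l, Rplus_0_l.
apply sum_eq; intros k Hk; cbn [Nat.sub pow]; ring.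
Qed.

Lemma hsum_mul_r (c : nat -> R) (n : nat) (a b : R) :
  c (S n) = 0 -> b * hsum c n a b = hsum c (S n) a b.
Proof.
intros Hc; unfold hsum; rewrite scal_sum, tech5, Hc, !Rmult_0_l, Rplus_0_r.
apply sum_eq; intros k Hk; rewrite Nat.sub_succ_l by lia; simpl; ring.
Qed.

Lemma hsum_lin (u v w : R) (c d e : nat -> R) (n : nat) (a b : R) :
  u * hsum c n a b + v * hsum d n a b + w * hsum e n a b
  = hsum (fun k => u * c k + v * d k + w * e k) n a b.
Proof.
unfold hsum; rewrite !scal_sum, <- !sum_plus.
apply sum_eq; intros k Hk; ring.
Qed.

Lemma hsum_ext (c d : nat -> R) (n : nat) (a b : R) :
  (forall k, c k = d k) -> hsum c n a b = hsum d n a b.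
Proof.
intros H; apply sum_eq; intros k Hk; rewrite H; reflexivity.
Qed.

Lemma gbinom_sqr_vanish (n j : nat) : gbinom_sqr (INR n) (S n + j) = 0.
Proof.
unfold gbinom_sqr; rewrite gbinom_vanish; ring.
Qed.

(** The variables [a] and [b] take the parts of [z] and [1] in the coefficient
    recurrence.  Raising the degree by multiplying by [b] keeps the coefficient
    sequence, because the row of [INR n] vanishes beyond [n]. *)
Lemma hsum_three_term (m : nat) (a b : R) :
  let h n := hsum (gbinom_sqr (INR n)) n a b in
  (INR m + 2) * h (S (S m))
  = (2 * INR m + 3) * (a + b) * h (S m) - (INR m + 1) * (a - b) ^ 2 * h m.
Proof.
intros h; unfold h; clear h.
set (s0 := gbinom_sqr (INR m)); set (s1 := gbinom_sqr (INR (S m))).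
set (s2 := gbinom_sqr (INR (S (S m)))).
assert (Hs0 : s0 (S m) = 0).
{ rewrite <- (gbinom_sqr_vanish m 0); unfold s0; f_equal; lia. }
assert (Hs0' : s0 (S (S m)) = 0).
{ rewrite <- (gbinom_sqr_vanish m 1); unfold s0; f_equal; lia. }
assert (Hs1 : s1 (S (S m)) = 0).
{ rewrite <- (gbinom_sqr_vanish (S m) 0); unfold s1; f_equal; lia. }
pose proof (hsum_mul_l s1 (S m) a b) as Ha1.
pose proof (hsum_mul_r s1 (S m) a b Hs1) as Hb1.
pose proof (hsum_mul_l s0 m a b) as Ha.
pose proof (hsum_mul_r s0 m a b Hs0) as Hb.
pose proof (hsum_mul_l (PS_incr_1 s0) (S m) a b) as Haa.
pose proof (hsum_mul_l s0 (S m) a b) as Hab.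
pose proof (hsum_mul_r s0 (S m) a b Hs0') as Hbb.
rewrite <- Ha in Haa; rewrite <- Hb in Hab, Hbb.
replace ((2 * INR m + 3) * (a + b) * hsum s1 (S m) a b
         - (INR m + 1) * (a - b) ^ 2 * hsum s0 m a b)
  with (1 * ((2 * INR m + 3) * (a * hsum s1 (S m) a b)
             + (2 * INR m + 3) * (b * hsum s1 (S m) a b)
             + - (INR m + 1) * (a * (a * hsum s0 m a b)))
        + 2 * (INR m + 1) * (a * (b * hsum s0 m a b))
        + - (INR m + 1) * (b * (b * hsum s0 m a b))) by ring.
rewrite Ha1, Hb1, Haa, Hab, Hbb, !hsum_lin.
replace ((INR m + 2) * hsum s2 (S (S m)) a b)
  with ((INR m + 2) * hsum s2 (S (S m)) a b + 0 * hsum s2 (S (S m)) a b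
        + 0 * hsum s2 (S (S m)) a b) by ring.
rewrite hsum_lin; apply hsum_ext; intros k.
pose proof (gbinom_sqr_three_term (INR m + 1) k) as H.
replace (INR m + 1 - 1) with (INR m) in H by ring.
unfold s0, s1, s2; rewrite !S_INR; lra.
Qed.

Lemma F_hsum (n : nat) (x : R) :
  F n x = hsum (gbinom_sqr (INR n)) n (x ^ 2) ((1 - x) ^ 2).
Proof.
apply sum_eq; intros k Hk; unfold gbinom_sqr.
rewrite gbinom_C by exact Hk.
rewrite !Rpow_mult_distr, <- !pow_mult, (Nat.mul_comm 2 k), (Nat.mul_comm 2).
reflexivity.
Qed.

Lemma F_three_term (n : nat) (x : R) :
  (1 <= n)%nat ->
  2 * (INR n + 1) * F (n + 1) x
  = (2 * INR n + 1) * (1 + (1 - 2 * x) ^ 2) * F n x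
    - 2 * INR n * (1 - 2 * x) ^ 2 * F (n - 1) x.
Proof.
intros Hn; destruct n as [|m]; [lia|].
replace (S m + 1)%nat with (S (S m)) by lia.
replace (S m - 1)%nat with m by lia.
pose proof (hsum_three_term m (x ^ 2) ((1 - x) ^ 2)) as H; cbv beta zeta in H.
rewrite !F_hsum.
set (h0 := hsum _ m _ _) in *; set (h1 := hsum _ (S m) _ _) in *.
set (h2 := hsum _ (S (S m)) _ _) in *.
rewrite S_INR.
transitivity (2 * ((INR m + 2) * h2)); [ring|rewrite H; ring].
Qed.

Lemma U_F (n : nat) (t : R) : 0 <= t -> U n t = F n (t / (1 + t)).
Proof.
intros Ht; apply sum_eq; intros k Hk; f_equal.
replace (1 - t / (1 + t)) with (/ (1 + t)) by (field; lra).
replace ((1 + t) ^ n) with ((1 + t) ^ k * (1 + t) ^ (n - k))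
  by (rewrite <- pow_add; f_equal; lia).
unfold Rdiv; rewrite Rpow_mult_distr, !pow_inv.
field; split; apply pow_nonzero; lra.
Qed.

(** * Power series and the functions [J] and [G] *)

(** The ratio [((nu - k) / (k + 1))^2] of consecutive coefficients tends to
    [1]; for [nu < 0] no coefficient vanishes, as the ratio test requires. *)
Lemma ex_pseries_gbinom_sqr (nu z : R) :
  nu < 0 -> Rabs z < 1 -> ex_pseries (gbinom_sqr nu) z.
Proof.
intros Hnu Hz; apply CV_radius_inside.
rewrite (CV_radius_finite_DAlembert _ 1); [simpl; lra| |lra|].
- intros k; apply pow_nonzero, gbinom_neg_neq_0, Hnu.
- apply is_lim_seq_ext with (fun k => (-1 + (nu + 1) * / INR (S k)) ^ 2).
  + intros k; pose proof (pos_INR k).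
    pose proof (gbinom_neg_neq_0 nu k Hnu).
    replace (gbinom_sqr nu (S k) / gbinom_sqr nu k)
      with ((-1 + (nu + 1) * / INR (S k)) ^ 2).
    * rewrite Rabs_pos_eq; [reflexivity|apply pow2_ge_0].
    * rewrite S_INR; unfold gbinom_sqr; simpl; field; lra.
  + assert (Hinv : is_lim_seq (fun k => / INR (S k)) 0).
    { apply (is_lim_seq_incr_1 (fun k => / INR k)).
      apply (is_lim_seq_inv _ p_infty); [apply is_lim_seq_INR|discriminate]. }
    assert (Hlin : is_lim_seq (fun k => -1 + (nu + 1) * / INR (S k))
                     (-1 + (nu + 1) * 0)).
    { apply is_lim_seq_plus'; [apply is_lim_seq_const|].
      apply is_lim_seq_mult'; [apply is_lim_seq_const|exact Hinv]. }
    replace (Finite 1)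
      with (Finite ((-1 + (nu + 1) * 0) * ((-1 + (nu + 1) * 0) * 1)))
      by (f_equal; ring).
    apply is_lim_seq_mult'; [exact Hlin|].
    apply is_lim_seq_mult'; [exact Hlin|apply is_lim_seq_const].
Qed.

Lemma PSeries_gbinom_sqr_three_term (nu z : R) :
  nu + 1 < 0 -> Rabs z < 1 ->
  (nu + 1) * PSeries (gbinom_sqr (nu + 1)) z
  = (2 * nu + 1) * (1 + z) * PSeries (gbinom_sqr nu) z
    - nu * (1 - z) ^ 2 * PSeries (gbinom_sqr (nu - 1)) z.
Proof.
intros Hnu Hz.
set (s := gbinom_sqr nu); set (s' := gbinom_sqr (nu - 1)).
assert (Cs : ex_pseries s z) by (apply ex_pseries_gbinom_sqr; lra).
assert (Cs' : ex_pseries s' z) by (apply ex_pseries_gbinom_sqr; lra).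
pose proof (ex_pseries_incr_1 _ _ Cs) as Czs.
pose proof (ex_pseries_incr_1 _ _ Cs') as Czs'.
pose proof (ex_pseries_incr_1 _ _ Czs') as Czzs'.
assert (Cscal : forall c (a : nat -> R), ex_pseries a z ->
                ex_pseries (PS_scal c a) z).
{ intros c a; apply ex_pseries_scal, Rmult_comm. }
rewrite <- PSeries_scal.
rewrite (PSeries_ext _
  (PS_plus (PS_scal (2 * nu + 1) (PS_plus s (PS_incr_1 s)))
     (PS_scal (- nu) (PS_plus (PS_plus s' (PS_scal (-2) (PS_incr_1 s')))
                        (PS_incr_1 (PS_incr_1 s')))))).
- rewrite PSeries_plus, !PSeries_scal, !PSeries_plus, !PSeries_scal,
    !PSeries_incr_1; auto using @ex_pseries_plus.
  ring.
- intros k; unfold PS_plus, PS_scal.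
  transitivity ((nu + 1) * gbinom_sqr (nu + 1) k); [reflexivity|].
  rewrite gbinom_sqr_three_term; fold s s'.
  unfold plus, scal; simpl; unfold mult; simpl; ring.
Qed.

Lemma J_PSeries (n : nat) (t : R) :
  J n t = ((1 - t) ^ (n + 1)) ^ 2 * PSeries (gbinom_sqr (- INR n - 1)) (t ^ 2).
Proof.
unfold J, PSeries; rewrite <- Series_scal_l; apply Series_ext; intros k.
unfold gbinom_sqr; rewrite gbinom_neg_C, !Rpow_mult_distr.
rewrite <- (pow_mult (-1)), (Nat.mul_comm k 2), pow_1_even.
rewrite <- !(pow_mult t), (Nat.mul_comm 2 k); ring.
Qed.

Lemma J_three_term (n : nat) (t : R) :
  (1 <= n)%nat -> 0 <= t < 1 ->
  (INR n + 1) * (1 + t) ^ 2 * J (n + 1) t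
  = (2 * INR n + 1) * (t ^ 2 + 1) * J n t
    - INR n * (1 - t) ^ 2 * J (n - 1) t.
Proof.
intros Hn Ht; destruct n as [|m]; [lia|].
replace (S m + 1)%nat with (S (S m)) by lia.
replace (S m - 1)%nat with m by lia.
pose proof (pos_INR m).
assert (Hz : Rabs (t ^ 2) < 1) by (rewrite Rabs_pos_eq; nra).
pose proof (PSeries_gbinom_sqr_three_term (- INR m - 2) (t ^ 2)) as H0.
specialize (H0 ltac:(lra) Hz).
rewrite !J_PSeries, !S_INR.
replace (- INR m - 2 + 1) with (- INR m - 1) in H0 by ring.
replace (- INR m - 2 - 1) with (- (INR m + 1 + 1) - 1) in H0 by ring.
replace (- INR m - 2) with (- (INR m + 1) - 1) in H0 by ring.
set (p0 := PSeries (gbinom_sqr (- INR m - 1)) _) in *.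
set (p1 := PSeries (gbinom_sqr (- (INR m + 1) - 1)) _) in *.
set (p2 := PSeries (gbinom_sqr (- (INR m + 1 + 1) - 1)) _) in *.
cbn [Nat.add]; cbn [pow]; set (e := (1 - t) ^ (m + 1)).
(* The factors [(1 - t)^2] and [(1 + t)^2] around [J] multiply to the
   [(1 - z)^2] of the power series recurrence at [z = t^2]. *)
apply Rminus_diag_uniq.
transitivity ((e * (1 - t)) ^ 2
  * ((INR m + 2) * (1 - t ^ 2) ^ 2 * p2
     - (2 * INR m + 3) * (1 + t ^ 2) * p1 + (INR m + 1) * p0)); [ring|].
transitivity ((e * (1 - t)) ^ 2 * 0); [f_equal; lra|ring].
Qed.

Lemma G_J (n : nat) (x : R) :
  (1 <= n)%nat -> 0 <= x -> G n x = J (n - 1) (x / (1 + x)).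
Proof.
intros Hn Hx; apply Series_ext; intros k; f_equal.
replace (1 - x / (1 + x)) with (/ (1 + x)) by (field; lra).
replace (n - 1 + 1)%nat with n by lia.
replace (n - 1 + k)%nat with (n + k - 1)%nat by lia.
unfold Rdiv; rewrite Rpow_mult_distr, !pow_inv, pow_add.
field; split; apply pow_nonzero; lra.
Qed.

(** * The four recurrences *)

Theorem theorem1 :
  (forall (n : nat) (x : R), (1 <= n)%nat -> 0 <= x <= 1 ->
     2 * (INR n + 1) * F (n + 1) x
     = (2 * INR n + 1) * (1 + (1 - 2 * x) ^ 2) * F n x
       - 2 * INR n * (1 - 2 * x) ^ 2 * F (n - 1) x)
  /\
  (forall (n : nat) (x : R), (2 <= n)%nat -> 0 <= x ->
     INR n * (1 + 2 * x) ^ 2 * G (n + 1) x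
     = (2 * INR n - 1) * (1 + 2 * x + 2 * x ^ 2) * G n x
       - (INR n - 1) * G (n - 1) x)
  /\
  (forall (n : nat) (t : R), (1 <= n)%nat -> 0 <= t ->
     (INR n + 1) * (1 + t) ^ 2 * U (n + 1) t
     = (2 * INR n + 1) * (t ^ 2 + 1) * U n t
       - INR n * (1 - t) ^ 2 * U (n - 1) t)
  /\
  (forall (n : nat) (t : R), (1 <= n)%nat -> 0 <= t < 1 ->
     (INR n + 1) * (1 + t) ^ 2 * J (n + 1) t
     = (2 * INR n + 1) * (t ^ 2 + 1) * J n t
       - INR n * (1 - t) ^ 2 * J (n - 1) t).
Proof.
split; [|split; [|split]].
- intros n x Hn _; apply F_three_term, Hn.
- intros n x Hn Hx.
  rewrite !G_J by (lia || lra).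
  set (t := x / (1 + x)).
  assert (Hinv : 0 < / (1 + x)) by (apply Rinv_0_lt_compat; lra).
  assert (Ht : 0 <= t < 1).
  { replace t with (1 - / (1 + x)) by (unfold t; field; lra).
    split; [|lra].
    replace (1 - / (1 + x)) with (x * / (1 + x)) by (field; lra); nra. }
  pose proof (J_three_term (n - 1) t ltac:(lia) Ht) as H.
  replace (n - 1 + 1)%nat with n in H by lia.
  replace (n + 1 - 1)%nat with n by lia.
  rewrite minus_INR in H by lia; simpl (INR 1) in H.
  replace (1 + 2 * x) with ((1 + x) * (1 + t)) by (unfold t; field; lra).
  replace ((1 + x) * (1 + t) + 2 * x ^ 2) with ((1 + x) ^ 2 * (t ^ 2 + 1))
    by (unfold t; field; lra).
  (* Multiplying the recurrence for [J] at [t] by [(1 + x)^2] turns its three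
     coefficients into those for [G]. *)
  assert (H1 : ((1 + x) * (1 - t)) ^ 2 = 1) by (unfold t; field; lra).
  transitivity ((1 + x) ^ 2 * ((INR n - 1 + 1) * (1 + t) ^ 2 * J n t));
    [ring|rewrite H].
  transitivity ((2 * INR n - 1) * ((1 + x) ^ 2 * (t ^ 2 + 1)) * J (n - 1) t
    - (INR n - 1) * ((1 + x) * (1 - t)) ^ 2 * J (n - 1 - 1) t); [ring|].
  rewrite H1; ring.
- intros n t Hn Ht.
  rewrite !U_F by exact Ht.
  pose proof (F_three_term n (t / (1 + t)) Hn) as H.
  replace (1 - 2 * (t / (1 + t))) with ((1 - t) / (1 + t)) in H
    by (field; lra).
  set (f2 := F (n + 1) _) in *; set (f1 := F n _) in *.
  set (f0 := F (n - 1) _) in *.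
  transitivity ((1 + t) ^ 2 / 2 * (2 * (INR n + 1) * f2)); [field|].
  rewrite H; field; lra.
- intros n t Hn Ht; apply J_three_term; assumption.
Qed.
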